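(* There exists a universal constant $C>0$ such that the following holds. Let $n\ge1$, let $K>0$, and let $X$ be a mean zero random vector in $\mathbb{R}^n$ which has the concentration property with constant $K$. Let $\mathcal{A}$ be a nonempty bounded set of real $n\times n$ matrices and consider the random variable $$Z=\sup_{A\in\mathcal{A}}\big(X^TAX-\mathbb{E}X^TAX\big).$$ Then, for every $t>0$, $$\mathbb{P}(|Z-\mathbb{E}Z|\ge t)\le 2\exp\Big(-\frac1C\min\Big(\frac{t^2}{K^2\|X\|_{\mathcal{A}}^2},\frac{t}{K^2\sup_{A\in\mathcal{A}}\|A\|}\Big)\Big),$$ where $$\|X\|_{\mathcal{A}}=\mathbb{E}\sup_{A\in\mathcal{A}}|(A+A^T)X|.$$
   Context: $|\cdot|$ is the standard Euclidean norm on $\mathbb{R}^n$ and $\|A\|=\sup_{|x|\le1}|Ax|$ is the operator norm of a matrix $A$. A fraction with positive numerator and zero denominator is read as $+\infty$, and $\exp(-\infty)=0$. Concentration property: a random vector $X$ in $\mathbb{R}^n$ has the concentration property with constant $K$ if for every function $\varphi:\mathbb{R}^n\to\mathbb{R}$ that is 1-Lipschitz (with respect to $|\cdot|$), we have $\mathbb{E}|\varphi(X)|<\infty$ and for every $t>0$, $$\mathbb{P}(|\varphi(X)-\mathbb{E}\varphi(X)|\ge t)\le 2\exp(-t^2/K^2).$$ *)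

(* Defs.v *)
From mathcomp Require Export all_boot all_order all_algebra.
From mathcomp Require Export all_classical all_reals all_analysis.
Export Order.TTheory GRing.Theory Num.Theory.
Export numFieldNormedType.Exports.

Set Implicit Arguments.
Unset Strict Implicit.
Unset Printing Implicit Defensive.

Local Open Scope classical_set_scope.
Local Open Scope ring_scope.

(* The library's [`|x|] on matrices is the max norm, hence a separate notion. *)
Definition enorm (R : realType) (n : nat) (x : 'cV[R]_n) : R :=
  Num.sqrt (\sum_(i < n) x i 0 ^+ 2).

Definition opnorm (R : realType) (n : nat) (A : 'M[R]_n) : R :=
  sup [set enorm (A *m x) | x in [set x : 'cV[R]_n | enorm x <= 1]].

Definition quadform (R : realType) (n : nat) (A : 'M[R]_n) (x : 'cV[R]_n) : R :=
  (x^T *m A *m x) 0 0.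

(* Coordinatewise measurability is Borel measurability, as n is finite. *)
Definition random_vector d (T : measurableType d) (R : realType) (n : nat)
    (X : T -> 'cV[R]_n) : Prop :=
  forall i : 'I_n, measurable_fun [set: T] (fun w => X w i 0).

Definition mean_zero d (T : measurableType d) (R : realType)
    (P : probability T R) (n : nat) (X : T -> 'cV[R]_n) : Prop :=
  forall i : 'I_n, ('E_P[fun w => X w i 0%R] = 0)%E.

Definition lipschitz1 (R : realType) (n : nat) (phi : 'cV[R]_n -> R) : Prop :=
  forall x y : 'cV[R]_n, `|phi x - phi y| <= enorm (x - y).

Definition concentration d (T : measurableType d) (R : realType)
    (P : probability T R) (n : nat) (X : T -> 'cV[R]_n) (K : R) : Prop :=
  forall phi : 'cV[R]_n -> R, lipschitz1 phi ->
    ('E_P[fun w => `|phi (X w)|%R] < +oo)%E /\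
    forall t : R, 0 < t ->
      (P [set w | t%:E <= `|(phi (X w))%:E - 'E_P[fun w => phi (X w)]|] <=
         (2 * expR (- (t ^+ 2 / K ^+ 2)))%:E)%E.

Definition bounded_matrices (R : realType) (n : nat) (AA : set 'M[R]_n) : Prop :=
  has_ubound [set opnorm A | A in AA].

(* [fine] loses nothing: under the concentration property every quadratic form
   of X has a finite expectation. *)
Definition chaos_sup d (T : measurableType d) (R : realType)
    (P : probability T R) (n : nat) (X : T -> 'cV[R]_n) (AA : set 'M[R]_n)
    (w : T) : R :=
  sup [set quadform A (X w) - fine ('E_P[fun w' => quadform A (X w')])%E | A in AA].

Definition set_norm d (T : measurableType d) (R : realType)
    (P : probability T R) (n : nat) (X : T -> 'cV[R]_n) (AA : set 'M[R]_n)
    : \bar R :=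
  'E_P[fun w => sup [set enorm ((A + A^T)%R *m X w) | A in AA]]%E.

Definition sup_opnorm (R : realType) (n : nat) (AA : set 'M[R]_n) : R :=
  sup [set opnorm A | A in AA].

(* Main.v *)
Require Import Defs.
From mathcomp Require Import measurable_realfun ring lra.

(** Put [g x = sup_A |(A + A^T) x|], [M = E g(X)], [S = sup_A |A|] (operator
    norms) and [f x = sup_A (x^T A x - E X^T A X)], so that [Z = f(X)]. Two
    facts about these functions carry the proof, and the concentration argument
    uses nothing else about matrices: [g] is [2S]-Lipschitz, and by polarization
    (quadformB) [f] is [a]-Lipschitz on the sublevel set [g <= a]
    (lipschitz_quad_sup).

    Let [t, q > 0] satisfy [q K^2 M^2 <= t^2] and [q K^2 (2S) <= t], that is,
    up to constants, let [q] be at most the minimum in the exponent. Take the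
    level [a = 2t / (K sqrt q)]. The concentration property for [g] gives
    [P (g(X) > a) <= 2 exp(-q)], because the two conditions on [q] say that
    both [M] and the fluctuation of [g(X)] are at most [a / 2]. McShane's
    extension of [f] from [g <= a] to an [a]-Lipschitz function [h] satisfies
    [P (|h(X) - E h(X)| >= 2t) <= 2 exp(-q)]. Hence [f(X)] is within [2t] of
    [m = E h(X)] except with probability [4 exp(-q)] (truncated_tail).

    The centre [m] depends on [(t, q)] and has to be replaced by [E f(X)]. The
    conditions are stable under [(t, q) |-> (kt, kq)] for [k >= 1], and the
    centre at scale [kt] differs from [m] by at most [2t + 2kt], since when [q]
    is not small both good events meet. So [P (|f(X) - m| >= 6kt) <=
    4 exp(-kq)] for every integer [k >= 1], and summation over [k] gives
    [E |f(X) - m| <= 12t] (uniform_center). Therefore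
    [P (|f(X) - E f(X)| >= 14t) <= 4 exp(-q)] for [q >= 6], and a change of
    constants gives the bound with prefactor [2] for all [q]
    (locally_lipschitz_concentration).

    Two preliminaries make the expectations meaningful. Lipschitz and locally
    Lipschitz functions of a random vector are measurable, being determined
    through countably many cones or sublevel sets; and [E |X|^2] is finite, so
    that the centring terms [E X^T A X] are uniformly bounded and the suprema
    are finite. *)

Set Implicit Arguments.
Unset Strict Implicit.
Unset Printing Implicit Defensive.

Local Open Scope classical_set_scope.
Local Open Scope ring_scope.

(** * Euclidean geometry and quadratic forms *)

Section Euclidean.
Context (R : realType).
Implicit Types n : nat.

Definition dotp n (x y : 'cV[R]_n) : R := \sum_i x i 0 * y i 0.

Lemma dotpC n (x y : 'cV[R]_n) : dotp x y = dotp y x.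
Proof. by apply: eq_bigr => i _; rewrite mulrC. Qed.

Lemma dotpDl n (x y z : 'cV[R]_n) : dotp (x + y) z = dotp x z + dotp y z.
Proof. by rewrite -big_split; apply: eq_bigr => i _; rewrite !mxE mulrDl. Qed.

Lemma dotpNl n (x z : 'cV[R]_n) : dotp (- x) z = - dotp x z.
Proof. by rewrite -sumrN; apply: eq_bigr => i _; rewrite !mxE mulNr. Qed.

Lemma dotpDr n (x y z : 'cV[R]_n) : dotp z (x + y) = dotp z x + dotp z y.
Proof. by rewrite dotpC dotpDl !(dotpC z). Qed.

Lemma dotpE n (x y : 'cV[R]_n) : dotp x y = (x^T *m y) 0 0.
Proof. by rewrite mxE; apply: eq_bigr => i _; rewrite !mxE. Qed.

Lemma dotp_adjoint n (A : 'M[R]_n) (x y : 'cV[R]_n) :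
  dotp x (A *m y) = dotp (A^T *m x) y.
Proof. by rewrite !dotpE trmx_mul trmxK mulmxA. Qed.

Lemma quadformE n (A : 'M[R]_n) (x : 'cV[R]_n) :
  quadform A x = dotp x (A *m x).
Proof. by rewrite /quadform dotpE mulmxA. Qed.

Lemma enorm_ge0 n (x : 'cV[R]_n) : 0 <= enorm x.
Proof. exact: sqrtr_ge0. Qed.

Lemma sqr_enorm n (x : 'cV[R]_n) : enorm x ^+ 2 = dotp x x.
Proof.
rewrite /enorm sqr_sqrtr; last by apply: sumr_ge0 => i _; exact: sqr_ge0.
by apply: eq_bigr => i _; rewrite expr2.
Qed.

Lemma enorm0 n : enorm (0 : 'cV[R]_n) = 0.
Proof.
rewrite /enorm big1 ?sqrtr0// => i _.
by rewrite mxE expr0n.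
Qed.

Lemma enormN n (x : 'cV[R]_n) : enorm (- x) = enorm x.
Proof. by congr Num.sqrt; apply: eq_bigr => i _; rewrite mxE sqrrN. Qed.

Lemma enormB n (x y : 'cV[R]_n) : enorm (x - y) = enorm (y - x).
Proof. by rewrite -enormN opprB. Qed.

Lemma enormZ n (c : R) (x : 'cV[R]_n) : enorm (c *: x) = `|c| * enorm x.
Proof.
rewrite /enorm -sqrtr_sqr -sqrtrM ?sqr_ge0// mulr_sumr.
by congr Num.sqrt; apply: eq_bigr => i _; rewrite mxE exprMn.
Qed.

Lemma enorm_eq0 n (x : 'cV[R]_n) : enorm x = 0 -> x = 0.
Proof.
move=> x0; have : dotp x x = 0 by rewrite -sqr_enorm x0 expr0n.
move/eqP; rewrite psumr_eq0; last by move=> i _; rewrite -expr2 sqr_ge0.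
move=> /allP xi0; apply/matrixP => i j; rewrite ord1 mxE.
by have := xi0 i (mem_index_enum _); rewrite -expr2 sqrf_eq0 => /eqP.
Qed.

(** Cauchy-Schwarz: expand the square of the norm of [|y| x - |x| y]. *)
Lemma dotp_le_enorm n (x y : 'cV[R]_n) : dotp x y <= enorm x * enorm y.
Proof.
have [/enorm_eq0 ->|x0] := eqVneq (enorm x) 0.
  by rewrite enorm0 mul0r /dotp big1// => i _; rewrite mxE mul0r.
have [/enorm_eq0 ->|y0] := eqVneq (enorm y) 0.
  by rewrite enorm0 mulr0 /dotp big1// => i _; rewrite mxE mulr0.
have a0 : 0 < enorm x by rewrite lt_def x0 enorm_ge0.
have b0 : 0 < enorm y by rewrite lt_def y0 enorm_ge0.
set a := enorm x in a0 *; set b := enorm y in b0 *.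
have : 0 <= \sum_i (b * x i 0 - a * y i 0) ^+ 2.
  by apply: sumr_ge0 => i _; exact: sqr_ge0.
have -> : \sum_i (b * x i 0 - a * y i 0) ^+ 2 =
    b ^+ 2 * dotp x x + a ^+ 2 * dotp y y - 2 * a * b * dotp x y.
  rewrite !mulr_sumr -sumrN -!big_split /=; apply: eq_bigr => i _.
  by ring.
rewrite -!sqr_enorm -/a -/b.
have -> : b ^+ 2 * a ^+ 2 + a ^+ 2 * b ^+ 2 - 2 * a * b * dotp x y =
          (2 * a * b) * (a * b - dotp x y) by ring.
by rewrite pmulr_rge0 ?subr_ge0// !mulr_gt0.
Qed.

Lemma ler_enormD n (x y : 'cV[R]_n) : enorm (x + y) <= enorm x + enorm y.
Proof.
rewrite -ler_sqr ?nnegrE ?addr_ge0 ?enorm_ge0//.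
rewrite sqr_enorm dotpDl !dotpDr (dotpC y x) -!sqr_enorm.
have := dotp_le_enorm x y; lra.
Qed.

Lemma ler_enorm_sub n (x y : 'cV[R]_n) : enorm x <= enorm y + enorm (x - y).
Proof. by rewrite -[leLHS](congr1 (@enorm _ _) (subrK y x)) addrC ler_enormD. Qed.

Lemma lipschitz1_enorm n : lipschitz1 (@enorm R n).
Proof.
move=> x y; have := ler_enorm_sub x y; have := ler_enorm_sub y x.
by rewrite enormB ler_norml => ? ?; apply/andP; split; lra.
Qed.

Lemma ler_coord_enorm n (x : 'cV[R]_n) i : `|x i 0| <= enorm x.
Proof.
rewrite -sqrtr_sqr ler_wsqrtr// (bigD1 i)//= lerDl.
by apply: sumr_ge0 => j _; exact: sqr_ge0.
Qed.

Lemma enorm_le_sum n (x : 'cV[R]_n) : enorm x <= \sum_i `|x i 0|.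
Proof.
have s0 : 0 <= \sum_i `|x i 0| by apply: sumr_ge0.
rewrite -ler_sqr ?nnegrE ?enorm_ge0// sqr_enorm expr2 mulr_suml.
apply: ler_sum => i _; rewrite (le_trans (ler_norm _))// normrM ler_wpM2l//.
by rewrite (bigD1 i)//= lerDl sumr_ge0.
Qed.

(** A finite bound on the operator norm, needed because [sup] is meaningless
    on an unbounded set. *)
Lemma enorm_mulmx_bounded n (A : 'M[R]_n) (x : 'cV[R]_n) :
  enorm (A *m x) <= (\sum_i \sum_j `|A i j|) * enorm x.
Proof.
rewrite (le_trans (enorm_le_sum _))// mulr_suml ler_sum// => i _.
rewrite mxE (le_trans (ler_norm_sum _ _ _))// mulr_suml ler_sum// => j _.
by rewrite normrM ler_wpM2l// ler_coord_enorm.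
Qed.

Lemma has_sup_opnorm n (A : 'M[R]_n) :
  has_sup [set enorm (A *m x) | x in [set x : 'cV[R]_n | enorm x <= 1]].
Proof.
split; first by exists (enorm (A *m 0)), 0 => //=; rewrite enorm0.
exists (\sum_i \sum_j `|A i j|) => _ [x /= x1 <-].
rewrite (le_trans (enorm_mulmx_bounded _ _))// ler_piMr//.
by apply: sumr_ge0 => i _; apply: sumr_ge0.
Qed.

Lemma opnorm_ge0 n (A : 'M[R]_n) : 0 <= opnorm A.
Proof.
apply: (le_trans (enorm_ge0 (A *m 0))); apply: (ub_le_sup (has_sup_opnorm A).2).
by exists 0 => //=; rewrite enorm0.
Qed.

Lemma enorm_mulmx n (A : 'M[R]_n) (x : 'cV[R]_n) :
  enorm (A *m x) <= opnorm A * enorm x.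
Proof.
have [/enorm_eq0 ->|x0] := eqVneq (enorm x) 0.
  by rewrite mulmx0 !enorm0 mulr0.
have a0 : 0 < enorm x by rewrite lt_def x0 enorm_ge0.
rewrite -ler_pdivrMr//.
have -> : enorm (A *m x) / enorm x = enorm (A *m ((enorm x)^-1 *: x)).
  by rewrite -scalemxAr enormZ ger0_norm ?invr_ge0 ?enorm_ge0// mulrC.
apply: (ub_le_sup (has_sup_opnorm A).2); eexists; last reflexivity.
by rewrite /= enormZ ger0_norm ?invr_ge0 ?enorm_ge0// mulVf.
Qed.

(** [|A^T x|^2 = <x, A A^T x> <= |x| |A| |A^T x|]. *)
Lemma enorm_mulmx_tr n (A : 'M[R]_n) (x : 'cV[R]_n) :
  enorm (A^T *m x) <= opnorm A * enorm x.
Proof.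
set y := A^T *m x.
have [->|y0] := eqVneq (enorm y) 0.
  by rewrite mulr_ge0 ?opnorm_ge0 ?enorm_ge0.
have b0 : 0 < enorm y by rewrite lt_def y0 enorm_ge0.
rewrite -(ler_pM2r b0) -expr2 sqr_enorm {1}/y -dotp_adjoint.
rewrite (le_trans (dotp_le_enorm _ _))// mulrAC mulrC ler_wpM2r ?enorm_ge0//.
exact: enorm_mulmx.
Qed.

Lemma enorm_symmetrized n (A : 'M[R]_n) (x : 'cV[R]_n) :
  enorm ((A + A^T) *m x) <= 2 * opnorm A * enorm x.
Proof.
rewrite mulmxDl (le_trans (ler_enormD _ _))//.
by have := enorm_mulmx A x; have := enorm_mulmx_tr A x; lra.
Qed.

(** Polarization; the cross terms [x^T A y] cancel after symmetrization. *)
Lemma quadformB n (A : 'M[R]_n) (x y : 'cV[R]_n) :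
  quadform A x - quadform A y = dotp (x - y) ((A + A^T) *m (x + y)) / 2.
Proof.
rewrite !quadformE mulmxDl !mulmxDr !(dotpDl, dotpDr) !dotpNl.
have E u v : dotp u (A^T *m v) = dotp v (A *m u).
  by rewrite dotp_adjoint trmxK dotpC.
by rewrite !E; field.
Qed.

Lemma quadformB_le n (A : 'M[R]_n) (x y : 'cV[R]_n) (a : R) :
  enorm ((A + A^T) *m x) <= a -> enorm ((A + A^T) *m y) <= a ->
  quadform A x - quadform A y <= a * enorm (x - y).
Proof.
move=> xa ya; rewrite quadformB ler_pdivrMr//.
rewrite (le_trans (dotp_le_enorm _ _))// [leLHS]mulrC mulrAC ler_wpM2r ?enorm_ge0//.
by rewrite mulmxDr (le_trans (ler_enormD _ _))//; lra.
Qed.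

Lemma quadform_le n (A : 'M[R]_n) (x : 'cV[R]_n) :
  `|quadform A x| <= opnorm A * enorm x ^+ 2.
Proof.
have le u v : dotp u (A *m v) <= enorm u * (opnorm A * enorm v).
  by rewrite (le_trans (dotp_le_enorm _ _))// ler_wpM2l ?enorm_ge0 ?enorm_mulmx.
rewrite quadformE expr2 mulrCA ler_norml le// andbT lerNl -dotpNl.
by rewrite -[X in _ <= X * _]enormN le.
Qed.

End Euclidean.

(** * Lipschitz functions on subsets *)

Definition lipschitz_on (R : realType) n (D : set 'cV[R]_n) (l : R)
    (f : 'cV[R]_n -> R) : Prop :=
  forall x y, D x -> D y -> f x - f y <= l * enorm (x - y).

Section Lipschitz.
Context (R : realType) (n : nat).
Implicit Types (f g : 'cV[R]_n -> R) (D : set 'cV[R]_n).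

Lemma lipschitz_on_norm D l f x y : lipschitz_on D l f -> D x -> D y ->
  `|f x - f y| <= l * enorm (x - y).
Proof.
move=> fl Dx Dy; rewrite ler_norml fl// andbT lerNl opprB enormB.
exact: fl.
Qed.

(** McShane's extension [inf_y (f y + l |x - y|)], the infimum over [D]. *)
Lemma lipschitz_extension D l f : 0 <= l -> lipschitz_on D l f ->
  exists h, lipschitz_on setT l h /\ (forall x, D x -> h x = f x).
Proof.
move=> l0 fl.
have [[y0 Dy0]|D0] := pselect (D !=set0); last first.
  exists (fun=> 0); split.
    by move=> x y _ _; rewrite subrr mulr_ge0// enorm_ge0.
  by move=> x Dx; exfalso; apply: D0; exists x.
pose V x := [set f y + l * enorm (x - y) | y in D].
have V0 x : V x !=set0 by exists (f y0 + l * enorm (x - y0)), y0.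
have lbV x : has_lbound (V x).
  exists (f y0 - l * enorm (x - y0)) => _ [y Dy <-].
  have := fl _ _ Dy0 Dy.
  have : l * enorm (y0 - y) <= l * (enorm (x - y0) + enorm (x - y)).
    rewrite ler_wpM2l// (enormB x y0) (le_trans _ (ler_enormD _ _))//.
    by rewrite addrA subrK.
  lra.
exists (fun x => inf (V x)); split.
- move=> x y _ _; rewrite lerBlDr -lerBlDl; apply: lb_le_inf => //.
  move=> _ [z Dz <-].
  have : inf (V x) <= f z + l * enorm (x - z) by apply: ge_inf => //; exists z.
  have : l * enorm (x - z) <= l * (enorm (x - y) + enorm (y - z)).
    by rewrite ler_wpM2l// (le_trans _ (ler_enormD _ _))// addrA subrK.
  lra.
- move=> x Dx; apply/eqP; rewrite eq_le; apply/andP; split.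
    apply: ge_inf => //; exists x => //.
    by rewrite subrr enorm0 mulr0 addr0.
  apply: lb_le_inf => // _ [y Dy <-].
  by have := fl _ _ Dx Dy; lra.
Qed.

Lemma rat_vector_approx (x : 'cV[R]_n) (e : R) : 0 < e ->
  exists q : 'cV[rat]_n, enorm (x - map_mx ratr q) <= e.
Proof.
move=> e0; pose d := e / n.+1%:R.
have d0 : 0 < d by rewrite divr_gt0.
have /choice[q qP] : forall i : 'I_n, exists q : rat, `|x i 0 - ratr q| <= d.
  move=> i; have /rat_in_itvoo[q] : x i 0 - d < x i 0 + d by lra.
  rewrite in_itv/= => /andP[q1 q2]; exists q.
  by rewrite ler_norml; apply/andP; split; lra.
exists (\col_i q i); rewrite (le_trans (enorm_le_sum _))//.
apply: (@le_trans _ _ (\sum_(i < n) d)).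
  by apply: ler_sum => i _; rewrite !mxE.
rewrite sumr_const card_ord -mulr_natr /d mulrAC ler_pdivrMr//.
by rewrite ler_wpM2l ?ltW// ltr_nat.
Qed.

End Lipschitz.

(** * Measurability of Lipschitz functions of a random vector *)

Section Measurability.
Context d (T : measurableType d) (R : realType) (n : nat).
Implicit Types (X : T -> 'cV[R]_n).

Lemma measurable_fun_lt_rays (Y : T -> R) :
  (forall c, measurable [set w | Y w < c]) -> measurable_fun [set: T] Y.
Proof.
move=> mY mD; apply: (measurability _ (RGenInftyO.measurableE R)) => //.
move=> _ [_ [x ->] <-]; rewrite setTI.
rewrite (_ : _ @^-1` _ = [set w | Y w < x])//.
Qed.

Lemma measurable_lt_ray (Y : T -> R) c :
  measurable_fun [set: T] Y -> measurable [set w | Y w < c].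
Proof.
move=> mY; rewrite (_ : [set _ | _] = [set: T] `&` Y @^-1` `]-oo, c[%classic).
  by apply: mY => //; exact: measurable_itv.
by rewrite setTI; apply/seteqP; split => w /=; rewrite in_itv.
Qed.

Lemma measurable_ge_ray (Y : T -> R) c :
  measurable_fun [set: T] Y -> measurable [set w | c <= Y w].
Proof.
move=> mY; rewrite (_ : [set _ | _] = [set: T] `&` Y @^-1` `[c, +oo[%classic).
  by apply: mY => //; exact: measurable_itv.
by rewrite setTI; apply/seteqP; split => w /=; rewrite in_itv/= andbT.
Qed.

Lemma measurable_enormB X (y : 'cV[R]_n) : random_vector X ->
  measurable_fun [set: T] (fun w => enorm (X w - y)).
Proof.
move=> mX; apply: (measurableT_comp (continuous_measurable_fun (@sqrt_continuous R))).
apply: (eq_measurable_fun (fun w => \sum_(i < n) (X w i 0 - y i 0) ^+ 2)).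
  by move=> w _; apply: eq_bigr => i _; rewrite !mxE.
apply: measurable_sum => i; apply: measurable_funX.
apply: measurable_funB; [exact: mX|exact: measurable_cst].
Qed.

(** The value of a Lipschitz function at [x] is the infimum of the cones
    [f q + l |x - q|] with rational apex [q]. *)
Lemma measurable_lipschitz X l (f : 'cV[R]_n -> R) : 0 <= l ->
  random_vector X -> lipschitz_on setT l f ->
  measurable_fun [set: T] (fun w => f (X w)).
Proof.
move=> l0 mX fl; apply: measurable_fun_lt_rays => c.
pose cone (q : 'cV[rat]_n) w :=
  f (map_mx ratr q) + l * enorm (X w - map_mx ratr q).
rewrite (_ : [set _ | _] = \bigcup_q [set w | cone q w < c]).
  apply: countable_bigcupT_measurable => [|q]; first exact: countableP.
  apply: measurable_lt_ray; apply: measurable_funD => //.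
  by apply: measurable_funM => //; exact: measurable_enormB.
apply/seteqP; split => w /=.
- move=> fc; pose e := (c - f (X w)) / (2 * (l + 1)).
  have e0 : 0 < e by rewrite divr_gt0 ?subr_gt0// mulr_gt0//; lra.
  have [q Xq] := rat_vector_approx (X w) e0; exists q => //=.
  have lX : l * enorm (X w - map_mx ratr q) <= l * e by rewrite ler_wpM2l.
  have fq := fl (map_mx ratr q) (X w) I I.
  rewrite enormB in fq.
  have : 2 * (l * e) < c - f (X w).
    rewrite (_ : c - f (X w) = 2 * (l + 1) * e); last by rewrite /e; field; lra.
    by rewrite -mulrA ltr_pM2l// ltr_pM2r//; lra.
  by rewrite /cone; lra.
- move=> [q _] /=; apply: le_lt_trans.
  by have := fl (X w) (map_mx ratr q) I I; rewrite /cone; lra.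
Qed.

(** [f] agrees with a Lipschitz function on each of the countably many
    sublevel sets [g <= k]. *)
Lemma measurable_locally_lipschitz X l (f g : 'cV[R]_n -> R) : 0 <= l ->
  random_vector X -> lipschitz_on setT l g ->
  (forall a, 0 <= a -> lipschitz_on [set x | g x <= a] a f) ->
  measurable_fun [set: T] (fun w => f (X w)).
Proof.
move=> l0 mX gl fg; apply: measurable_fun_lt_rays => c.
have /choice[h hP] : forall k : nat, exists h,
    lipschitz_on setT k%:R h /\ (forall x, g x <= k%:R -> h x = f x).
  by move=> k; apply: lipschitz_extension => //; exact: fg.
rewrite (_ : [set _ | _] =
    \bigcup_k (~` [set w | - g (X w) < - k%:R] `&` [set w | h k (X w) < c])).
  apply: bigcupT_measurable => k; apply: measurableI.
    apply/measurableC/measurable_lt_ray.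
    by apply: measurable_funN; exact: measurable_lipschitz gl.
  by apply: measurable_lt_ray; apply: measurable_lipschitz (hP k).1.
apply/seteqP; split => w /=.
- move=> fc; have [k gk] : exists k : nat, g (X w) <= k%:R.
    exists (Num.truncn `|g (X w)|).+1; rewrite (le_trans (ler_norm _))//.
    by rewrite ltW// truncnS_gt.
  exists k => //; split => /=; first by rewrite ltrN2 => /(le_lt_trans gk); rewrite ltxx.
  by rewrite (hP k).2.
- move=> [k _ [/= /negP]]; rewrite ltrN2 -leNgt => gk.
  by rewrite (hP k).2.
Qed.

End Measurability.

(** * Summation of tail bounds *)

(** [8 = 2 ^ 3 <= e ^ 3]; the factor [4] is absorbed since [4 <= 4 ^ k]. *)
Lemma expR_le_dyadic (R : realType) (k : nat) (u : R) :
  (0 < k)%N -> 3 * k%:R <= u -> 4 * expR (- u) <= 2 ^- k.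
Proof.
move=> k0 ku; have e2 : 2 <= expR (1 : R).
  by rewrite (le_trans _ (expR_ge1Dx _))//; lra.
rewrite expRN -[leRHS]mul1r -(ler_pM2r (expR_gt0 u)).
rewrite mulfVK ?gt_eqF ?expR_gt0// mul1r mulrC ler_pdivlMr ?exprn_gt0//.
rewrite (@le_trans _ _ (8 ^+ k))//; last first.
  rewrite (le_trans _ (_ : expR (3 * k%:R) <= _)) ?ler_expR//.
  rewrite expRM_natr lerXn2r ?nnegrE ?expR_ge0//.
  rewrite -[X in expR X]mulr1 expRM_natl.
  have -> : 8 = 2 ^+ 3 :> R by ring.
  by rewrite lerXn2r ?nnegrE ?expR_ge0.
have -> : 8 = 4 * 2 :> R by ring.
rewrite exprMn ler_pM2r ?exprn_gt0//.
by case: k k0 {ku} => // k _; rewrite exprS ler_peMr// exprn_ege1//; lra.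
Qed.

Section Tails.
Context d (T : measurableType d) (R : realType) (P : probability T R).

Lemma probability_setU_le (A B : set T) (a b : R) :
  measurable A -> measurable B -> (P A <= a%:E)%E -> (P B <= b%:E)%E ->
  (P (A `|` B) <= (a + b)%:E)%E.
Proof.
move=> mA mB Aa Bb; rewrite (le_trans (measureU2 _ mA mB))// EFinD.
exact: leeD.
Qed.

Lemma probability_lt1_witness (A : set T) (a : R) :
  (P A <= a%:E)%E -> a < 1 -> exists w, ~ A w.
Proof.
move=> Pa a1; apply/not_existsP => AT.
have : (P [set: T] <= a%:E)%E.
  rewrite (_ : [set: T] = A)//; apply/seteqP; split => // w _.
  by apply: contrapT; exact: AT.
by rewrite probability_setT lee_fin leNgt a1.
Qed.

(** [Y <= r sum_(k >= 0) 1_(Y >= r k)], whose expectation is dominated by a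
    geometric series. *)
Lemma integral_le_dyadic_tail (Y : T -> R) (r : R) : 0 < r ->
  measurable_fun [set: T] Y -> (forall w, 0 <= Y w) ->
  (forall k : nat, (0 < k)%N ->
    (P [set w | (r * k%:R <= Y w)%R] <= (2 ^- k)%:E)%E) ->
  (\int[P]_w (Y w)%:E <= (2 * r)%:E)%E.
Proof.
move=> r0 mY Y0 tail.
pose A k := [set w | r * k%:R <= Y w].
have mA k : measurable (A k) by exact: measurable_ge_ray.
have mI k : measurable_fun [set: T] (fun w => (r * \1_(A k) w)%:E).
  by apply/measurable_EFinP; apply: measurable_funM => //.
have I0 k w : (0 <= (r * \1_(A k) w)%:E)%E.
  by rewrite lee_fin mulr_ge0 ?(ltW r0)// indicE.
apply: (@le_trans _ _ (\int[P]_w (\sum_(0 <= k <oo) (r * \1_(A k) w)%:E))%E).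
  apply: ge0_le_integral => //.
  - by move=> w _; rewrite lee_fin.
  - exact/measurable_EFinP.
  - by apply: ge0_emeasurable_sum.
  move=> w _.
  have exk : exists k, Y w < r * k%:R.
    exists (Num.truncn (Y w / r)).+1.
    by rewrite mulrC -ltr_pdivrMr// truncnS_gt.
  case: (ex_minnP exk) => N YN Nmin.
  apply: (@le_trans _ _ (\sum_(0 <= k < N) (r * \1_(A k) w)%:E)%E); last first.
    exact: nneseries_lim_ge.
  rewrite sumEFin lee_fin ltW// (lt_le_trans YN)// big_nat.
  rewrite (eq_bigr (fun=> r)); last first.
    move=> k /andP[_ kN]; rewrite indicE mem_set ?mulr1// /A /= leNgt.
    by apply/negP => /Nmin; rewrite leqNgt kN.
  by rewrite -big_nat sumr_const_nat subn0 mulr_natr.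
rewrite integral_nneseries//.
have <- : (\sum_(0 <= k <oo) ((2 * r) / (2 ^ (k + 1))%:R)%:E)%E = (2 * r)%:E.
  have := @cvg_geometric_eseries_half R (2 * r) 0.
  by rewrite expr0 divr1 => /(cvg_lim (@ereal_hausdorff R)).
apply: lee_nneseries => [k _ _|k _]; first exact: integral_ge0.
under eq_integral do rewrite EFinM.
rewrite ge0_integralZl_EFin//=; [|exact/measurable_EFinP|exact: ltW].
rewrite integral_indic// setIT.
have -> : 2 * r / (2 ^ (k + 1))%:R = r * 2 ^- k.
  by rewrite natrX addn1 exprS invfM mulrACA divff// mul1r.
rewrite EFinM lee_pmul2l//.
case: k => [|k]; last exact: tail.
by rewrite expr0 invr1 probability_le1.
Qed.

End Tails.

(** * Lipschitz functions under the concentration property *)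

Section Concentration.
Context d (T : measurableType d) (R : realType) (P : probability T R).
Context (n : nat) (X : T -> 'cV[R]_n) (K : R).
Hypotheses (K0 : 0 < K) (mX : random_vector X) (cX : concentration P X K).

Definition mean (f : 'cV[R]_n -> R) : R := fine ('E_P[fun w => f (X w)])%E.

Lemma lipschitz_integrable l f : 0 < l -> lipschitz_on setT l f ->
  P.-integrable [set: T] (fun w => (f (X w))%:E).
Proof.
move=> l0 fl; have mf := measurable_lipschitz (ltW l0) mX fl.
have fl1 : lipschitz1 (fun x => l^-1 * f x).
  move=> x y; rewrite -mulrBr normrM gtr0_norm ?invr_gt0// ler_pdivrMl//.
  exact: lipschitz_on_norm fl _ _.
have [+ _] := cX fl1; rewrite unlock => fin.
have : P.-integrable [set: T] (fun w => (l^-1 * f (X w))%:E).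
  apply/integrableP; split => //.
  by apply/measurable_EFinP; exact: measurable_funM.
move=> /(integrableZl measurableT l) /=.
by under eq_fun do rewrite -EFinM mulrA divff ?gt_eqF// mul1r.
Qed.

Lemma meanE l f : 0 < l -> lipschitz_on setT l f ->
  ('E_P[fun w => f (X w)] = (mean f)%:E)%E.
Proof.
move=> l0 fl; rewrite /mean fineK// unlock integrable_fin_num//.
exact: lipschitz_integrable fl.
Qed.

(** The hypothesis on [u] stands for [u <= s^2 / (l K)^2], by scaling [f] to
    Lipschitz constant [1]. *)
Lemma lipschitz_tail l f (s u : R) : 0 < l -> lipschitz_on setT l f ->
  0 < s -> u * (l * K) ^+ 2 <= s ^+ 2 ->
  (P [set w | (s <= `|f (X w) - mean f|)%R] <= (2 * expR (- u))%:E)%E.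
Proof.
move=> l0 fl s0 us.
have fl1 : lipschitz1 (fun x => l^-1 * f x).
  move=> x y; rewrite -mulrBr normrM gtr0_norm ?invr_gt0// ler_pdivrMl//.
  exact: lipschitz_on_norm fl _ _.
have [_ /(_ (s / l))] := cX fl1; rewrite divr_gt0// => /(_ isT).
have -> : ('E_P[fun w => (l^-1 * f (X w))%R] = (l^-1 * mean f)%:E)%E.
  rewrite EFinM -(meanE l0 fl) unlock -integralZl//.
  exact: lipschitz_integrable fl.
rewrite (_ : [set _ | _] = [set w | (s <= `|f (X w) - mean f|)%R]); last first.
  apply/seteqP; split => w /=; rewrite ?lee_fin -mulrBr normrM;
  by rewrite gtr0_norm ?invr_gt0// mulrC ler_pM2l ?invr_gt0.
move=> /le_trans; apply; rewrite lee_fin ler_pM2l// ler_expR lerN2.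
rewrite ler_pdivlMr ?exprn_gt0// expr_div_n ler_pdivlMr ?exprn_gt0//.
by rewrite -mulrA -exprMn (mulrC K).
Qed.

(** The norm is Lipschitz, so [|X|^2] has exponential tails; these are summed
    at multiples of a large enough constant. *)
Lemma second_moment_bound :
  exists r : R, (\int[P]_w (enorm (X w) ^+ 2)%:E <= r%:E)%E.
Proof.
have nl : lipschitz_on setT 1 (@enorm R n).
  by move=> x y _ _; rewrite mul1r (le_trans (ler_norm _))// lipschitz1_enorm.
pose m := mean (@enorm R n); pose b := 2 * `|m| + 4 * K.
(* [b] dominates both [2 E |X|] and [sqrt 12 K], and [r = b ^ 2]. *)
have b0 : 0 < b by rewrite /b ltr_wpDl ?mulr_gt0 ?mulr_ge0.
exists (2 * b ^+ 2); apply: integral_le_dyadic_tail.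
- exact: exprn_gt0.
- by apply: measurable_funX; exact: measurable_lipschitz nl.
- by move=> w; exact: sqr_ge0.
move=> k k0; have k1 : 1 <= k%:R :> R by rewrite ler1n.
pose s := b / 2 * Num.sqrt k%:R.
have sk1 : 1 <= Num.sqrt k%:R :> R by rewrite -[leLHS]sqrtr1 ler_wsqrtr.
have s0 : 0 < s by rewrite mulr_gt0 ?divr_gt0// (lt_le_trans ltr01).
have mn : measurable_fun [set: T] (fun w => `|enorm (X w) - m|).
  apply: measurableT_comp => //; apply: measurable_funB => //.
  exact: measurable_lipschitz nl.
apply: (@le_trans _ _ (P [set w | (s <= `|enorm (X w) - m|)%R])).
  apply: le_measure; rewrite ?inE.
  - apply: measurable_ge_ray; apply: measurable_funX.
    exact: measurable_lipschitz nl.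
  - exact: measurable_ge_ray.
  move=> w /= bk; rewrite (le_trans _ (ler_norm _))// lerBrDl.
  have : b * Num.sqrt k%:R <= enorm (X w).
    have bs0 : 0 <= b * Num.sqrt k%:R by rewrite mulr_ge0 ?sqrtr_ge0 ?(ltW b0).
    by rewrite -ler_sqr ?nnegrE ?enorm_ge0// exprMn sqr_sqrtr.
  have : m <= b / 2 * Num.sqrt k%:R.
    rewrite (le_trans (ler_norm _))// -[leLHS]mulr1 ler_pM// /b.
    by have := ltW K0; lra.
  by rewrite /s; lra.
apply: (@le_trans _ _ (2 * expR (- (4 * k%:R)))%:E).
  apply: lipschitz_tail nl s0 _ => //.
  rewrite mul1r /s exprMn sqr_sqrtr// mulrAC ler_wpM2r//.
  rewrite [leLHS](_ : _ = (2 * K) ^+ 2); last by ring.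
  have Kb : 0 <= 2 * K <= b / 2 by rewrite /b; have := normr_ge0 m; have := ltW K0; lra.
  by case/andP: Kb => K20 Kb; rewrite ler_sqr ?nnegrE// (le_trans K20).
rewrite lee_fin (le_trans _ (expR_le_dyadic (u := 4 * k%:R) k0 _))//.
  by rewrite ler_pM2r ?expR_gt0//; lra.
by rewrite ler_pM2r//; lra.
Qed.

End Concentration.

(** * Concentration of locally Lipschitz functions *)

Section LocallyLipschitz.
Context d (T : measurableType d) (R : realType) (P : probability T R).
Context (n : nat) (X : T -> 'cV[R]_n) (K : R).
Hypotheses (K0 : 0 < K) (mX : random_vector X) (cX : concentration P X K).
Context (f g : 'cV[R]_n -> R) (L : R).
Hypotheses (L0 : 0 < L) (gL : lipschitz_on setT L g).
Hypothesis fg : forall a, 0 <= a -> lipschitz_on [set x | g x <= a] a f.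

Let M := mean P X g.

(** A division-free form of
    [q <= min (t^2 / (K^2 M^2), t / (K^2 L))], which keeps its meaning when
    [M = 0]. *)
Definition admissible (t q : R) : Prop :=
  [/\ 0 < t, 0 < q, q * (K ^+ 2 * M ^+ 2) <= t ^+ 2 & q * (K ^+ 2 * L) <= t].

Lemma admissibleZ (t q k : R) : 1 <= k -> admissible t q ->
  admissible (k * t) (k * q).
Proof.
move=> k1 [t0 q0 qM qL]; have k0 : 0 < k by lra.
split; rewrite ?mulr_gt0//; last by rewrite -mulrA ler_pM2l.
rewrite exprMn (expr2 k) -(mulrA k q) -(mulrA k k) ler_pM2l//.
rewrite (le_trans qM)// ler_peMl//.
exact: sqr_ge0.
Qed.

Lemma admissible_div (t q k : R) : 1 <= k -> admissible t q ->
  admissible (t / k) (q / k ^+ 2).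
Proof.
move=> k1 [t0 q0 qM qL]; have k0 : 0 < k by lra.
split; rewrite ?divr_gt0 ?exprn_gt0// mulrAC.
  by rewrite expr_div_n ler_pM2r ?invr_gt0 ?exprn_gt0.
rewrite expr2 invfM mulrA ler_pM2r ?invr_gt0// (le_trans _ qL)//.
rewrite ler_pdivrMr// ler_peMr// mulr_ge0 ?(ltW q0)//.
by rewrite mulr_ge0 ?sqr_ge0 ?ltW.
Qed.

Lemma measurable_f : measurable_fun [set: T] (fun w => f (X w)).
Proof. exact: measurable_locally_lipschitz (ltW L0) mX gL fg. Qed.

(** The McShane extension of [f] from [g <= a] concentrates around its mean with
    Lipschitz constant [a], and coincides with [f] outside an event controlled
    by the concentration of [g]. *)
Lemma truncated_tail (t q : R) : admissible t q ->
  exists m B, [/\ measurable B, (P B <= (4 * expR (- q))%:E)%E &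
    forall w, ~ B w -> `|f (X w) - m| < 2 * t].
Proof.
move=> [t0 q0 qM qL].
have s0 : 0 < Num.sqrt q by rewrite sqrtr_gt0.
(* Half of the level [a] bounds the mean of [g], the other half its fluctuation
   at probability scale [exp (- q)]. *)
pose b := t / (K * Num.sqrt q); pose a := 2 * b.
have b0 : 0 < b by rewrite divr_gt0// mulr_gt0.
have a0 : 0 < a by rewrite mulr_gt0.
have bE : q * (b * K) ^+ 2 = t ^+ 2.
  have qE : q = Num.sqrt q ^+ 2 by rewrite sqr_sqrtr// ltW.
  rewrite {1}qE /b; field; rewrite !gt_eqF//.
have Mb : M <= b.
  have [M0|M0] := leP M 0; first exact: (le_trans M0 (ltW b0)).
  rewrite -(ler_pM2r K0) -ler_sqr ?nnegrE ?(ltW (mulr_gt0 _ K0))//.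
  by rewrite -(ler_pM2l q0) bE exprMn (mulrC (M ^+ 2)).
have Lb : q * (L * K) ^+ 2 <= b ^+ 2.
  have qK : 0 < q * K ^+ 2 by rewrite mulr_gt0 ?exprn_gt0.
  rewrite -(ler_pM2l qK).
  have -> : q * K ^+ 2 * b ^+ 2 = t ^+ 2 by rewrite -bE; ring.
  have -> : q * K ^+ 2 * (q * (L * K) ^+ 2) = (q * (K ^+ 2 * L)) ^+ 2 by ring.
  by rewrite lerXn2r ?nnegrE ?(ltW t0)// !mulr_ge0 ?sqr_ge0 ?ltW.
have [h [ha hf]] := lipschitz_extension (ltW a0) (fg (ltW a0)).
have mg := measurable_lipschitz (ltW L0) mX gL.
have mh := measurable_lipschitz (ltW a0) mX ha.
pose B1 := [set w | b <= `|g (X w) - M|].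
pose B2 := [set w | 2 * t <= `|h (X w) - mean P X h|].
have mabs (Y : T -> R) c : measurable_fun [set: T] Y ->
    measurable_fun [set: T] (fun w => `|Y w - c|).
  by move=> mY; apply: measurableT_comp => //; exact: measurable_funB.
have mB1 : measurable B1 by apply: measurable_ge_ray; exact: mabs.
have mB2 : measurable B2 by apply: measurable_ge_ray; exact: mabs.
exists (mean P X h), (B1 `|` B2); split.
- exact: measurableU.
- have -> : 4 * expR (- q) = 2 * expR (- q) + 2 * expR (- q) by ring.
  apply: probability_setU_le => //.
    exact: (lipschitz_tail K0 mX cX L0 gL b0 Lb).
  apply: (lipschitz_tail K0 mX cX a0 ha); first by rewrite mulr_gt0.
  by rewrite -mulrA [in leLHS]exprMn mulrCA bE exprMn.
- move=> w /not_orP[/= nB1 nB2].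
  rewrite ltNge; apply/negP; rewrite -hf//.
  have : `|g (X w) - M| < b by rewrite ltNge; apply/negP.
  by have := ler_norm (g (X w) - M); rewrite /= /a; lra.
Qed.

(** The centres of the truncations at the scales [t] and [k t] both approximate
    [f X] at a common sample point, so a single centre serves every scale. *)
Lemma uniform_center (t q : R) : admissible t q -> 6 <= q ->
  exists m B, [/\ measurable B, (P B <= (4 * expR (- q))%:E)%E,
    forall w, ~ B w -> `|f (X w) - m| < 2 * t &
    (\int[P]_w (`|f (X w) - m|)%:E <= (12 * t)%:E)%E].
Proof.
move=> tq q6; have [m [B [mB PB Bm]]] := truncated_tail tq.
exists m, B; split => //; have [t0 q0 _ _] := tq.
have mfm : measurable_fun [set: T] (fun w => `|f (X w) - m|).
  apply: measurableT_comp => //; apply: measurable_funB => //.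
  exact: measurable_f.
have -> : 12 * t = 2 * (6 * t) by ring.
apply: integral_le_dyadic_tail => //; first by rewrite mulr_gt0.
move=> k k0; have k1 : 1 <= k%:R :> R by rewrite ler1n.
have [m' [B' [mB' PB' Bm']]] := truncated_tail (admissibleZ k1 tq).
have kq : 3 * k%:R <= k%:R * q by rewrite mulrC ler_pM2l ?(lt_le_trans ltr01)//; lra.
have tkt : t <= k%:R * t by rewrite ler_peMl// ltW.
have quarter : 4 * expR (- q) <= 4^-1.
  rewrite (le_trans (expR_le_dyadic (k := 2) _ _))//; lra.
have half : 4 * expR (- (k%:R * q)) <= 2^-1.
  rewrite (le_trans (expR_le_dyadic (k := 1) (u := k%:R * q) _ _))//.
  by rewrite mulr1 (le_trans _ kq)// ler_peMr.
(* The exceptional events have total probability at most [1/4 + 1/2]. *)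
have [w /not_orP[wB wB']] : exists w, ~ (B `|` B') w.
  apply: (probability_lt1_witness (probability_setU_le mB mB' PB PB')).
  lra.
have mm' : `|m' - m| < 4 * (k%:R * t).
  have := Bm _ wB; have := Bm' _ wB'.
  by rewrite !ltr_norml => /andP[? ?] /andP[? ?]; apply/andP; split; lra.
apply: (@le_trans _ _ (P B')).
  apply: le_measure; rewrite ?inE//; first exact: measurable_ge_ray.
  move=> v /= far; apply: contrapT => /Bm'; move: mm' far.
  have := ler_distD m' (f (X v)) m; lra.
rewrite (le_trans PB')// lee_fin; exact: expR_le_dyadic.
Qed.

(** [f X] differs from a constant by a function of finite first moment. *)
Lemma locally_lipschitz_integrable : P.-integrable [set: T] (fun w => (f (X w))%:E).
Proof.
(* Any scale [t] large enough to make [(t, 6)] admissible will do. *)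
pose t := 6 * (K ^+ 2 * M ^+ 2) + 6 * (K ^+ 2 * L) + 1.
have M0 : 0 <= K ^+ 2 * M ^+ 2 by rewrite mulr_ge0 ?sqr_ge0.
have KL0 : 0 < K ^+ 2 * L by rewrite mulr_gt0 ?exprn_gt0.
have tq : admissible t 6.
  split => //; rewrite /t; try lra.
  rewrite -[leLHS]mul1r ler_pM//; lra.
have [m [B [_ _ _ fm]]] := uniform_center tq (lexx _).
have mf := measurable_f.
have i1 : P.-integrable [set: T] (fun w => (f (X w) - m)%:E).
  apply/integrableP; split.
    by apply/measurable_EFinP; exact: measurable_funB.
  exact: le_lt_trans fm (ltry _).
have i2 : P.-integrable [set: T] (EFin \o cst m).
  by apply: finite_measure_integrable_cst.
have := integrableD measurableT i1 i2.
by under eq_fun do rewrite /= -EFinD subrK.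
Qed.
Let fint := locally_lipschitz_integrable.

Lemma locally_lipschitz_meanE : ('E_P[fun w => f (X w)] = (mean P X f)%:E)%E.
Proof. by rewrite /mean fineK// unlock integrable_fin_num. Qed.

(** The centre of the truncation is within [12 t] of the mean by the first
    moment bound, and [f X] is within [2 t] of the centre off a small event. *)
Lemma large_deviation (t q : R) : admissible t q -> 6 <= q ->
  (P [set w | (14 * t <= `|f (X w) - mean P X f|)%R] <= (4 * expR (- q))%:E)%E.
Proof.
move=> tq q6; have [m [B [mB PB Bm fm]]] := uniform_center tq q6.
have mf := measurable_f.
have mean_m : `|mean P X f - m| <= 12 * t.
  rewrite -lee_fin (le_trans _ fm)//.
  have -> : (`|mean P X f - m|%:E = `|\int[P]_w (f (X w) - m)%:E|)%E.
    under eq_integral do rewrite EFinB.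
    rewrite integralB//; last exact: finite_measure_integrable_cst.
    have := expectation_cst P m; rewrite unlock => ->.
    by have := locally_lipschitz_meanE; rewrite unlock => ->.
  rewrite (le_trans (le_abse_integral _ _ _))//.
  by apply/measurable_EFinP; exact: measurable_funB.
rewrite (le_trans _ PB)// le_measure ?inE//.
  apply: measurable_ge_ray; apply: measurableT_comp => //.
  exact: measurable_funB.
move=> w /= far; apply: contrapT => /Bm; move: mean_m far.
have := ler_distD m (f (X w)) (mean P X f); rewrite (distrC m); lra.
Qed.

(** For [q < 1176] the right-hand side exceeds [1]; otherwise the factor [4] of
    the previous bound is absorbed by weakening the exponent. *)
Lemma locally_lipschitz_concentration (t q : R) : admissible t q ->
  (P [set w | (t <= `|f (X w) - mean P X f|)%R] <=
    (2 * expR (- (q / 2352)))%:E)%E.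
Proof.
move=> tq; have [qs|qb] := ltP q 1176.
  apply: (@le_trans _ _ 1%E).
    apply/probability_le1/measurable_ge_ray; apply: measurableT_comp => //.
    by apply: measurable_funB => //; exact: measurable_f.
  by rewrite lee_fin; have := expR_ge1Dx (- (q / 2352)); lra.
have tq' : admissible (t / 14) (q / 14 ^+ 2) by apply: admissible_div => //; lra.
have q6 : 6 <= q / 14 ^+ 2 by rewrite ler_pdivlMr; lra.
have := large_deviation tq' q6.
rewrite mulrC divfK// => /le_trans; apply; rewrite lee_fin.
have -> : 4 * expR (- (q / 14 ^+ 2)) =
    2 * (2 * expR (- (q / 14 ^+ 2))) by ring.
rewrite ler_pM2l//.
have -> : - (q / 2352) = q * (11 / 2352) + - (q / 14 ^+ 2) by field.
rewrite expRD ler_pM2r ?expR_gt0//.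
rewrite (le_trans _ (expR_ge1Dx _))//; lra.
Qed.

End LocallyLipschitz.

(** * Suprema of quadratic forms *)

(** Suprema inherit one-sided comparisons; the Lipschitz bounds for suprema
    below follow with [c] a multiple of the distance. *)
Lemma sup_image_le (R : realType) (I : Type) (D : set I) (u v : I -> R) (c : R) :
  D !=set0 -> has_ubound [set v i | i in D] ->
  (forall i, D i -> u i <= v i + c) ->
  sup [set u i | i in D] <= sup [set v i | i in D] + c.
Proof.
move=> [i0 Di0] vb uv; apply: ge_sup; first by exists (u i0), i0.
move=> _ [i Di <-]; rewrite (le_trans (uv _ Di))// lerD2r.
by apply: ub_le_sup => //; exists i.
Qed.

Section QuadraticSup.
Context (R : realType) (n : nat) (AA : set 'M[R]_n).
Hypotheses (AA0 : AA !=set0) (bAA : bounded_matrices AA).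

(** The local Lipschitz constant of [quad_sup], as [(A + A^T) x] is the gradient
    of [quadform A] at [x]. *)
Definition grad_sup (x : 'cV[R]_n) : R :=
  sup [set enorm ((A + A^T) *m x) | A in AA].

Definition quad_sup (c : 'M[R]_n -> R) (x : 'cV[R]_n) : R :=
  sup [set quadform A x - c A | A in AA].

Lemma opnorm_le_sup A : AA A -> opnorm A <= sup_opnorm AA.
Proof. by move=> AAA; apply: ub_le_sup => //; exists A. Qed.

Lemma sup_opnorm_ge0 : 0 <= sup_opnorm AA.
Proof. by case: AA0 => A AAA; exact: le_trans (opnorm_ge0 A) (opnorm_le_sup AAA). Qed.

Lemma enorm_grad_le A x : AA A ->
  enorm ((A + A^T) *m x) <= 2 * sup_opnorm AA * enorm x.
Proof.
move=> AAA; rewrite (le_trans (enorm_symmetrized _ _))// -!mulrA ler_pM2l//.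
by rewrite ler_wpM2r ?enorm_ge0// opnorm_le_sup.
Qed.

Lemma has_ubound_grad x : has_ubound [set enorm ((A + A^T) *m x) | A in AA].
Proof.
by exists (2 * sup_opnorm AA * enorm x) => _ [A AAA <-]; exact: enorm_grad_le.
Qed.

Lemma enorm_le_grad_sup A x : AA A -> enorm ((A + A^T) *m x) <= grad_sup x.
Proof. by move=> AAA; apply: ub_le_sup; [exact: has_ubound_grad|exists A]. Qed.

Lemma lipschitz_grad_sup : lipschitz_on setT (2 * sup_opnorm AA) grad_sup.
Proof.
move=> x y _ _; rewrite lerBlDl; apply: sup_image_le => //.
  exact: has_ubound_grad.
move=> A AAA; rewrite (le_trans (ler_enorm_sub _ ((A + A^T) *m y)))// lerD2l.
by rewrite -mulmxBr; exact: enorm_grad_le.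
Qed.

(** The Lipschitz constant comes from polarization, as [x + y] is controlled by
    [grad_sup x + grad_sup y <= 2 a]; the bound on [c] keeps the suprema
    finite. *)
Lemma lipschitz_quad_sup c b : (forall A, AA A -> `|c A| <= b) ->
  forall a, 0 <= a -> lipschitz_on [set x | grad_sup x <= a] a (quad_sup c).
Proof.
move=> cb a a0 x y /= gx gy; rewrite lerBlDl; apply: sup_image_le => //.
  exists (sup_opnorm AA * enorm y ^+ 2 + b) => _ [A AAA <-].
  have := cb _ AAA; rewrite ler_norml => /andP[+ _].
  have : quadform A y <= sup_opnorm AA * enorm y ^+ 2.
    rewrite (le_trans (ler_norm _))// (le_trans (quadform_le _ _))//.
    by rewrite ler_wpM2r ?sqr_ge0// opnorm_le_sup.
  lra.
move=> A AAA.
have := quadformB_le (le_trans (enorm_le_grad_sup x AAA) gx)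
                     (le_trans (enorm_le_grad_sup y AAA) gy).
lra.
Qed.

End QuadraticSup.

(** * Concentration of the chaos *)

Section Chaos.
Context d (T : measurableType d) (R : realType) (P : probability T R).
Context (n : nat) (X : T -> 'cV[R]_n) (K : R) (AA : set 'M[R]_n).
Hypotheses (K0 : 0 < K) (mX : random_vector X) (cX : concentration P X K).
Hypotheses (AA0 : AA !=set0) (bAA : bounded_matrices AA).

Lemma measurable_quadform A : measurable_fun [set: T] (fun w => quadform A (X w)).
Proof.
apply: (eq_measurable_fun
  (fun w => \sum_(i < n) X w i 0 * \sum_(j < n) A i j * X w j 0)).
  move=> w _; rewrite quadformE; apply: eq_bigr => i _; congr (_ * _).
  by rewrite mxE.
apply: measurable_sum => i; apply: measurable_funM; first exact: mX.
by apply: measurable_sum => j; apply: measurable_funM => //; exact: mX.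
Qed.

Let centre A : R := fine ('E_P[fun w => quadform A (X w)])%E.

(** [|E X^T A X| <= |A| E |X|^2]. *)
Lemma centre_bounded : exists b : R, forall A, AA A -> `|centre A| <= b.
Proof.
have [r Xr] := second_moment_bound K0 mX cX.
exists (sup_opnorm AA * r) => A AAA.
have mN : measurable_fun [set: T] (fun w => enorm (X w) ^+ 2).
  apply: measurable_funX; apply: (@measurable_lipschitz _ _ _ _ _ 1) => //.
  by move=> x y _ _; rewrite mul1r (le_trans (ler_norm _))// lipschitz1_enorm.
have S0 := sup_opnorm_ge0 AA0 bAA.
have le : (`|'E_P[fun w => quadform A (X w)]| <= (sup_opnorm AA * r)%:E)%E.
  rewrite unlock (le_trans (le_abse_integral _ _ _))//.
    by apply/measurable_EFinP; exact: measurable_quadform.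
  rewrite EFinM (le_trans _ (lee_wpmul2l _ Xr))//.
  rewrite -ge0_integralZl_EFin//; last 2 first.
  - by move=> w _; rewrite lee_fin sqr_ge0.
  - exact/measurable_EFinP.
  apply: ge0_le_integral => //.
  - apply: measurableT_comp => //; apply/measurable_EFinP.
    exact: measurable_quadform.
  - by apply/measurable_EFinP; exact: measurable_funM.
  move=> w _; rewrite lee_fin (le_trans (quadform_le _ _))//.
  by rewrite ler_wpM2r ?sqr_ge0// opnorm_le_sup.
rewrite /centre; move: le; case: ('E_P[_])%E => [x|//|//].
by rewrite lee_fin.
Qed.

Lemma set_normE : 0 < sup_opnorm AA ->
  set_norm P X AA = (mean P X (grad_sup AA))%:E.
Proof.
move=> S0; apply: (meanE mX cX _ (lipschitz_grad_sup AA0 bAA)).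
by rewrite mulr_gt0.
Qed.

(** The gradient bound has Lipschitz constant [2 sup_opnorm AA], so only [q / 2]
    is admissible; this doubles the constant [2352]. *)
Lemma chaos_tail (t q : R) : 0 < sup_opnorm AA -> 0 < t -> 0 < q ->
  q * (K ^+ 2 * mean P X (grad_sup AA) ^+ 2) <= t ^+ 2 ->
  q * (K ^+ 2 * sup_opnorm AA) <= t ->
  (P [set w | t%:E <= `|(chaos_sup P X AA w)%:E - 'E_P[chaos_sup P X AA]|] <=
    (2 * expR (- (q / 4704)))%:E)%E.
Proof.
move=> S0 t0 q0 qM qS; have [b cb] := centre_bounded.
have L0 : 0 < 2 * sup_opnorm AA by rewrite mulr_gt0.
have gL := lipschitz_grad_sup AA0 bAA.
have fg := lipschitz_quad_sup AA0 bAA cb.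
have tq : admissible P X K (grad_sup AA) (2 * sup_opnorm AA) t (q / 2).
  split => //; first by rewrite divr_gt0.
    rewrite (le_trans _ qM)// ler_wpM2r ?(mulr_ge0 (sqr_ge0 _) (sqr_ge0 _))//; lra.
  by rewrite (_ : _ * _ = q * (K ^+ 2 * sup_opnorm AA))//; field.
have qC : q / 2 / 2352 = q / 4704 by field.
have EZ := locally_lipschitz_meanE K0 mX cX L0 gL fg.
change (chaos_sup P X AA) with (fun w => quad_sup AA centre (X w)).
rewrite EZ -qC.
rewrite [X in P X](_ : _ = [set w |
    (t <= `|quad_sup AA centre (X w) - mean P X (quad_sup AA centre)|)%R]).
  exact: (locally_lipschitz_concentration K0 mX cX L0 gL fg tq).
by apply/seteqP; split => w /=; rewrite lee_fin.
Qed.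

(** Here the gradient bound vanishes identically, so the chaos is constant. *)
Lemma chaos_tail0 (t : R) : sup_opnorm AA = 0 -> 0 < t ->
  (P [set w | t%:E <= `|(chaos_sup P X AA w)%:E - 'E_P[chaos_sup P X AA]|] = 0)%E.
Proof.
move=> S0 t0; have [b cb] := centre_bounded.
have g0 x : grad_sup AA x <= 0.
  have := lipschitz_grad_sup AA0 bAA (x := x) (y := 0) I I.
  have : grad_sup AA 0 <= 0.
    case: AA0 => A AAA; apply: ge_sup; first by exists (enorm ((A + A^T) *m 0)), A.
    by move=> _ [B _ <-]; rewrite mulmx0 enorm0.
  by rewrite S0 mulr0 mul0r; lra.
have fc x : quad_sup AA centre x = quad_sup AA centre 0.
  apply/eqP; rewrite -subr_eq0 -normr_le0 -(mul0r (enorm (x - 0))).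
  exact: lipschitz_on_norm (lipschitz_quad_sup AA0 bAA cb (lexx 0)) (g0 x) (g0 0).
have -> : chaos_sup P X AA = cst (quad_sup AA centre 0).
  by apply/funext => w; exact: fc.
rewrite expectation_cst (_ : [set _ | _] = set0) ?measure0//.
apply/seteqP; split => // w /=.
by rewrite subrr normr0 lee_fin leNgt t0.
Qed.

End Chaos.

(* Division in [\bar R] satisfies [x / 0 = +oo] for [0 < x], and
   [expeR -oo = 0]. *)
Theorem theorem2p4 (R : realType) :
  exists C : R, 0 < C /\
  forall (d : measure_display) (T : measurableType d) (P : probability T R)
    (n : nat) (K : R) (X : T -> 'cV[R]_n) (AA : set 'M[R]_n),
  (1 <= n)%N -> 0 < K ->
  random_vector X -> mean_zero P X -> concentration P X K ->
  AA !=set0 -> bounded_matrices AA ->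
  forall t : R, 0 < t ->
  (P [set w | t%:E <=
       `|(chaos_sup P X AA w)%:E - 'E_P[chaos_sup P X AA]|] <=
   2%:E * expeR (- ((C^-1)%:E *
     Order.min ((t ^+ 2)%:E / ((K ^+ 2)%:E * set_norm P X AA ^+ 2))
               (t%:E / ((K ^+ 2)%:E * (sup_opnorm AA)%:E)))))%E.
Proof.
exists 4704; split; first by rewrite ltr0n.
move=> d T P n K X AA _ K0 mX _ cX AA0 bAA t t0.
have := sup_opnorm_ge0 AA0 bAA; rewrite le_eqVlt => /predU1P[S0|S0].
  by rewrite (chaos_tail0 K0 mX cX AA0 bAA (esym S0) t0) mule_ge0// expeR_ge0.
rewrite (set_normE mX cX AA0 bAA S0); set M := mean P X (grad_sup AA).
set S := sup_opnorm AA.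
have K2 : 0 < K ^+ 2 by rewrite exprn_gt0.
have KS : 0 < K ^+ 2 * S by rewrite mulr_gt0.
(* When [M = 0] the first term of the minimum is [+oo] and [q] is the second. *)
suff [q [q0 qM qS ->]] : exists q : R, [/\ 0 < q,
    q * (K ^+ 2 * M ^+ 2) <= t ^+ 2, q * (K ^+ 2 * S) <= t &
    (Order.min ((t ^+ 2)%:E / ((K ^+ 2)%:E * M%:E ^+ 2))
               (t%:E / ((K ^+ 2)%:E * S%:E)) = q%:E)%E].
  have <- : ((2 * expR (- (q / 4704)))%:E =
             2%:E * expeR (- ((4704^-1)%:E * q%:E)))%E by rewrite (mulrC q).
  exact: (chaos_tail K0 mX cX AA0 bAA S0 t0 q0 qM qS).
have qS : (t%:E / ((K ^+ 2)%:E * S%:E) = (t / (K ^+ 2 * S))%:E)%E.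
  by rewrite -EFinM inver gt_eqF.
rewrite qS -EFin_expe -EFinM inver.
have [M0|M0] := eqVneq M 0.
  exists (t / (K ^+ 2 * S)); rewrite M0 expr0n/= !mulr0; split => //.
  - exact: divr_gt0.
  - exact: sqr_ge0.
  - by rewrite divfK ?gt_eqF.
  rewrite eqxx.
  by rewrite gt0_muley ?lte_fin ?exprn_gt0// min_r// leey.
have KM : 0 < K ^+ 2 * M ^+ 2 by rewrite mulr_gt0// exprn_even_gt0.
exists (Num.min (t ^+ 2 / (K ^+ 2 * M ^+ 2)) (t / (K ^+ 2 * S))).
split.
- by rewrite lt_min !divr_gt0// exprn_gt0.
- by rewrite -ler_pdivlMr// ge_min lexx.
- by rewrite -ler_pdivlMr// ge_min lexx orbT.
- by rewrite gt_eqF// -EFinM EFin_min.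
Qed.
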